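(* Let $I\subseteq\mathbb{R}$ be either $(a,b)$, $(a,b]$, $[a,b)$ or $[a,b]$, where $-\infty\le a<b\le\infty$, let $\alpha,\beta: I\to\mathbb{R}$ be continuous, and let $t_0\in(a,b)$. Consider the system $$\bm{x}'=A(t)\bm{x},\qquad A(t)=\begin{pmatrix}\alpha(t)&\beta(t)\\-\beta(t)&\alpha(t)\end{pmatrix},\qquad \bm{x}\in\mathbb{R}^2,\qquad (\ast)$$ and its fundamental matrix $X(t)=e^{\int_{t_0}^t\alpha(s)ds}\begin{pmatrix}\cos\int_{t_0}^t\beta(s)ds&\sin\int_{t_0}^t\beta(s)ds\\-\sin\int_{t_0}^t\beta(s)ds&\cos\int_{t_0}^t\beta(s)ds\end{pmatrix}$, $t\in I$. Then the following hold. (i) Suppose that $\kappa_{31}(t):=\int_t^b e^{-\int_t^s\alpha(\tau)d\tau}ds$ exists for all $t\in I$ and $\sup_{t\in I}\kappa_{31}(t)<\infty$. Then $(\ast)$ is Ulam stable on $I$, with an Ulam constant $K_{31}:=\sup_{t\in I}\kappa_{31}(t)$. Furthermore, if in addition $\lim_{t\to b-0}\int_{t_0}^t\alpha(s)ds=\infty$, then for any $\varepsilon>0$ and any continuously differentiable $\bm{\phi}: I\to\mathbb{R}^2$ satisfying $\sup_{t\in I}\|\bm{\phi}'(t)-A(t)\bm{\phi}(t)\|_2\le\varepsilon$, the limit $\lim_{t\to b-0}X^{-1}(t)\bm{\phi}(t)$ is a well-defined constant vector, and $\bm{x}(t)=X(t)\left(\lim_{s\to b-0}X^{-1}(s)\bm{\phi}(s)\right)$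 is the unique solution of $(\ast)$ such that $\sup_{t\in I}\|\bm{\phi}(t)-\bm{x}(t)\|_2\le K_{31}\varepsilon$. (ii) Suppose that $\kappa_{32}(t):=\int_a^t e^{\int_s^t\alpha(\tau)d\tau}ds$ exists for all $t\in I$ and $\sup_{t\in I}\kappa_{32}(t)<\infty$. Then $(\ast)$ is Ulam stable on $I$, with an Ulam constant $K_{32}:=\sup_{t\in I}\kappa_{32}(t)$. Furthermore, if in addition $\lim_{t\to a+0}\int_t^{t_0}\alpha(s)ds=-\infty$, then for any $\varepsilon>0$ and any continuously differentiable $\bm{\phi}: I\to\mathbb{R}^2$ satisfying $\sup_{t\in I}\|\bm{\phi}'(t)-A(t)\bm{\phi}(t)\|_2\le\varepsilon$, the limit $\lim_{t\to a+0}X^{-1}(t)\bm{\phi}(t)$ is a well-defined constant vector, and $\bm{x}(t)=X(t)\left(\lim_{s\to a+0}X^{-1}(s)\bm{\phi}(s)\right)$ is the unique solution of $(\ast)$ such that $\sup_{t\in I}\|\bm{\phi}(t)-\bm{x}(t)\|_2\le K_{32}\varepsilon$.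
   Context: $\|(v_1,v_2)^T\|_2=\sqrt{|v_1|^2+|v_2|^2}$ is the Euclidean norm. The integrals defining the $\kappa$'s are possibly improper, and ''exists'' means that they converge. For continuous $A: I\to\mathbb{R}^{2\times2}$, the equation $\bm{x}'=A(t)\bm{x}$, $\bm{x}\in\mathbb{R}^2$, is called Ulam stable on $I$ if there is a constant $K>0$ such that: for every $\varepsilon>0$ and every continuously differentiable $\bm{\phi}: I\to\mathbb{R}^2$ with $\sup_{t\in I}\|\bm{\phi}'(t)-A(t)\bm{\phi}(t)\|_2\le\varepsilon$, there exists a solution $\bm{x}: I\to\mathbb{R}^2$ of the equation with $\sup_{t\in I}\|\bm{\phi}(t)-\bm{x}(t)\|_2\le K\varepsilon$. Any such $K$ is called an Ulam constant for the equation on $I$. *)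

(* Defs.v *)
From Stdlib Require Import Reals Lra.
From Coquelicot Require Import Coquelicot.
Open Scope R_scope.

(** ** Intervals *)

(** The interval with endpoints [a] and [b]; [ca] and [cb] tell whether it is
    closed at [a] and at [b].  It is a set of real numbers, so closing it at an
    infinite endpoint adds nothing. *)
Definition interval (a b : Rbar) (ca cb : bool) (t : R) : Prop :=
  (if ca then Rbar_le a t else Rbar_lt a t) /\
  (if cb then Rbar_le t b else Rbar_lt t b).

(** The filters of [t -> b-0] and [t -> a+0]; for a finite endpoint they are
    [at_left] and [at_right]. *)
Definition left_of (b : Rbar) : (R -> Prop) -> Prop :=
  within (fun t : R => Rbar_lt t b) (Rbar_locally b).

Definition right_of (a : Rbar) : (R -> Prop) -> Prop :=
  within (fun t : R => Rbar_lt a t) (Rbar_locally a).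

Definition sup_on (I : R -> Prop) (f : R -> R) : Rbar :=
  Lub_Rbar (fun y => exists t, I t /\ y = f t).

(** ** Vectors and matrices *)

Definition enorm (v : R * R) : R :=
  sqrt (Rabs (fst v) ^ 2 + Rabs (snd v) ^ 2).

Definition mat2 (m00 m01 m10 m11 : R) : @matrix R 2 2 :=
  [[m00, m01], [m10, m11]].

Definition mulmv (M : @matrix R 2 2) (v : R * R) : R * R :=
  (coeff_mat 0 M 0 0 * fst v + coeff_mat 0 M 0 1 * snd v,
   coeff_mat 0 M 1 0 * fst v + coeff_mat 0 M 1 1 * snd v).

Definition det2 (M : @matrix R 2 2) : R :=
  coeff_mat 0 M 0 0 * coeff_mat 0 M 1 1 - coeff_mat 0 M 0 1 * coeff_mat 0 M 1 0.

(** The inverse matrix (see [inv2_l] and [inv2_r]). *)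
Definition inv2 (M : @matrix R 2 2) : @matrix R 2 2 :=
  mat2 (coeff_mat 0 M 1 1 / det2 M) (- coeff_mat 0 M 0 1 / det2 M)
       (- coeff_mat 0 M 1 0 / det2 M) (coeff_mat 0 M 0 0 / det2 M).

Lemma inv2_l (M : @matrix R 2 2) :
  det2 M <> 0 -> @Mmult R_Ring 2 2 2 (inv2 M) M = @Mone R_Ring 2.
Proof.
destruct M as [[m00 [m01 []]] [[m10 [m11 []]] []]].
cbv [det2 inv2 mat2 Mmult Mone mk_matrix coeff_mat coeff_Tn mk_Tn sum_n sum_n_m
     Iter.iter_nat]; simpl; intros H.
unfold plus, mult, zero, one; simpl.
repeat (apply f_equal2); try reflexivity;
  match goal with |- ?x = ?y => change (@eq R x y) end; field; exact H.
Qed.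

Lemma inv2_r (M : @matrix R 2 2) :
  det2 M <> 0 -> @Mmult R_Ring 2 2 2 M (inv2 M) = @Mone R_Ring 2.
Proof.
destruct M as [[m00 [m01 []]] [[m10 [m11 []]] []]].
cbv [det2 inv2 mat2 Mmult Mone mk_matrix coeff_mat coeff_Tn mk_Tn sum_n sum_n_m
     Iter.iter_nat]; simpl; intros H.
unfold plus, mult, zero, one; simpl.
repeat (apply f_equal2); try reflexivity;
  match goal with |- ?x = ?y => change (@eq R x y) end; field; exact H.
Qed.

(** ** Linear systems and Ulam stability *)

(** The analogue of [is_derive] for functions on [I]: one-sided at an endpoint
    belonging to [I]. *)
Definition is_derive_on (I : R -> Prop) (f : R -> R * R) (t : R) (l : R * R)
  : Prop :=
  filterdiff f (within I (locally t)) (fun y : R => scal y l).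

(** [f] is continuously differentiable on [I], with derivative [df]. *)
Definition is_C1_on (I : R -> Prop) (f df : R -> R * R) : Prop :=
  (forall t, I t -> is_derive_on I f t (df t)) /\ continuous_on I df.

Definition is_solution (I : R -> Prop) (A : R -> @matrix R 2 2)
  (x : R -> R * R) : Prop :=
  forall t, I t -> is_derive_on I x t (mulmv (A t) (x t)).

Definition residual_le (I : R -> Prop) (A : R -> @matrix R 2 2)
  (phi dphi : R -> R * R) (eps : R) : Prop :=
  Rbar_le (sup_on I (fun t => enorm (minus (dphi t) (mulmv (A t) (phi t))))) eps.

Definition dist_le (I : R -> Prop) (phi x : R -> R * R) (r : R) : Prop :=
  Rbar_le (sup_on I (fun t => enorm (minus (phi t) (x t)))) r.

Definition is_Ulam_constant (I : R -> Prop) (A : R -> @matrix R 2 2) (K : R)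
  : Prop :=
  0 < K /\
  forall (eps : R) (phi dphi : R -> R * R),
    0 < eps -> is_C1_on I phi dphi -> residual_le I A phi dphi eps ->
    exists x : R -> R * R, is_solution I A x /\ dist_le I phi x (K * eps).

Definition Ulam_stable (I : R -> Prop) (A : R -> @matrix R 2 2) : Prop :=
  exists K : R, is_Ulam_constant I A K.

(** Solutions are compared on [I] only. *)
Definition is_unique_solution_within (I : R -> Prop) (A : R -> @matrix R 2 2)
  (phi : R -> R * R) (r : R) (x : R -> R * R) : Prop :=
  is_solution I A x /\ dist_le I phi x r /\
  forall y : R -> R * R, is_solution I A y -> dist_le I phi y r ->
    forall t, I t -> y t = x t.

(** ** The system of the theorem *)

Definition sysA (alpha beta : R -> R) (t : R) : @matrix R 2 2 :=
  mat2 (alpha t) (beta t)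
       (- beta t) (alpha t).

Definition sysX (alpha beta : R -> R) (t0 t : R) : @matrix R 2 2 :=
  let e := exp (RInt alpha t0 t) in
  let B := RInt beta t0 t in
  mat2 (e * cos B) (e * sin B)
       (e * - sin B) (e * cos B).

Lemma det2_sysX (alpha beta : R -> R) (t0 t : R) :
  det2 (sysX alpha beta t0 t) = exp (RInt alpha t0 t) ^ 2.
Proof.
unfold det2, sysX, mat2, coeff_mat; simpl.
set (e := exp _); set (B := RInt beta t0 t).
pose proof (sin2_cos2 B) as H; unfold Rsqr in H.
transitivity (e ^ 2 * (sin B * sin B + cos B * cos B)); [ring | rewrite H; ring].
Qed.

(** [ex_kappa31] and [ex_kappa32] say that the improper integrals converge;
    only then are the values of [kappa31] and [kappa32] meaningful. *)
Definition ex_kappa31 (alpha : R -> R) (b : Rbar) (t : R) : Prop :=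
  ex_RInt_gen (fun s => exp (- RInt alpha t s)) (at_point t) (left_of b).

Definition kappa31 (alpha : R -> R) (b : Rbar) (t : R) : R :=
  RInt_gen (fun s => exp (- RInt alpha t s)) (at_point t) (left_of b).

Definition ex_kappa32 (alpha : R -> R) (a : Rbar) (t : R) : Prop :=
  ex_RInt_gen (fun s => exp (RInt alpha s t)) (right_of a) (at_point t).

Definition kappa32 (alpha : R -> R) (a : Rbar) (t : R) : R :=
  RInt_gen (fun s => exp (RInt alpha s t)) (right_of a) (at_point t).

(* Main.v *)
(** Variation of constants: if [phi] solves the system up to an error of norm
    at most [eps], then [X^{-1} phi] has derivative of norm at most
    [eps * exp (- int_{t0}^t alpha)], because [X] is [exp (int alpha)] times a
    rotation.  Convergence of [kappa] at one end of [I] therefore makes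
    [X^{-1} phi] Cauchy there, and its limit [v] satisfies
    [|phi t - X t v| <= eps * kappa t].  The two ends are treated together by
    letting [t] tend to the end along an abstract filter.  Two solutions differ
    by [X c], which is unbounded when [int alpha] tends to infinity, unless
    [c = 0]. *)
Require Import Defs.
From Stdlib Require Import Reals Lra.
From Coquelicot Require Import Coquelicot.
Open Scope R_scope.

Definition order_convex (I : R -> Prop) : Prop :=
  forall x y z, I x -> I y -> x <= z <= y -> I z.

Definition is_derive_within (I : R -> Prop) (f : R -> R) (t l : R) : Prop :=
  filterdiff f (within I (locally t)) (fun y : R => scal y l).

Lemma within_locally_proper (I : R -> Prop) (t : R) :
  I t -> ProperFilter (within I (locally t)).
Proof.
intros It; constructor.
- intros P HP; exists t; exact (locally_singleton _ _ HP It).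
- apply within_filter; apply locally_filter.
Qed.

Lemma within_locally_lim (I : R -> Prop) (t : R) :
  is_filter_lim (within I (locally t)) t.
Proof. intros P HP; unfold within; generalize HP; apply filter_imp; tauto. Qed.

Lemma is_derive_within_eps (I : R -> Prop) (f : R -> R) (t l : R) :
  I t ->
  (is_derive_within I f t l <->
   forall eps : posreal, within I (locally t)
     (fun y => Rabs (f y - f t - (y - t) * l) <= eps * Rabs (y - t))).
Proof.
intros It.
pose proof (within_locally_proper I t It) as PF.
split.
- intros [_ H] eps; exact (H t (within_locally_lim I t) eps).
- intros H; split; [apply (@is_linear_scal_l R_AbsRing R_NormedModule l) |].
  intros x Hx.
  assert (x = t) as ->.
  { symmetry; apply (is_filter_lim_unique (F := within I (locally t)));
      [apply within_locally_lim | exact Hx]. }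
  intros eps; exact (H eps).
Qed.

Lemma is_derive_within_continuous (I : R -> Prop) (f : R -> R) (t l : R) :
  I t -> is_derive_within I f t l ->
  filterlim f (within I (locally t)) (locally (f t)).
Proof.
intros It Hd.
pose proof (within_locally_proper I t It) as PF.
apply filterlim_locally; intros eps.
set (M := 1 + Rabs l).
assert (HM : 0 < M) by (unfold M; pose proof (Rabs_pos l); lra).
pose proof (proj1 (is_derive_within_eps I f t l It) Hd (mkposreal 1 Rlt_0_1)) as H1.
assert (Hr : 0 < eps / M) by (apply Rdiv_lt_0_compat; [apply cond_pos | exact HM]).
assert (H2 : within I (locally t) (fun y => ball t (mkposreal _ Hr) y)).
{ apply within_locally_lim; apply locally_ball. }
generalize (filter_and _ _ H1 H2); apply filter_imp; simpl.
intros y [Hy Hb].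
change (Rabs (f y - f t) < eps); change (Rabs (y - t) < eps / M) in Hb.
apply Rle_lt_trans with (M * Rabs (y - t)).
- replace (f y - f t) with ((f y - f t - (y - t) * l) + (y - t) * l) by ring.
  eapply Rle_trans; [apply Rabs_triang |].
  rewrite Rabs_mult; unfold M; lra.
- apply Rmult_lt_compat_l with (r := M) in Hb; [| exact HM].
  replace (M * (eps / M)) with (pos eps) in Hb by (field; lra); exact Hb.
Qed.

Lemma is_derive_within_interior (I : R -> Prop) (f : R -> R) (t l : R) :
  locally t I -> is_derive_within I f t l -> is_derive f t l.
Proof.
intros Ht [Hl H]; split; [exact Hl |].
intros x Hx; assert (x = t) as ->
  by (symmetry; apply is_filter_lim_locally_unique; exact Hx).
intros eps; generalize (filter_and _ _ Ht (H t (within_locally_lim I t) eps)).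
apply filter_imp; intros y [Iy Hy]; exact (Hy Iy).
Qed.

Lemma is_derive_within_of_is_derive (I : R -> Prop) (f : R -> R) (t l : R) :
  I t -> is_derive f t l -> is_derive_within I f t l.
Proof.
intros It H; pose proof (within_locally_proper I t It) as PF.
apply filterdiff_locally with t; [apply within_locally_lim | exact H].
Qed.

Lemma is_derive_within_eq (I : R -> Prop) (f : R -> R) (t l l' : R) :
  is_derive_within I f t l -> l = l' -> is_derive_within I f t l'.
Proof. intros H <-; exact H. Qed.

Lemma is_derive_within_ext (I : R -> Prop) (f g : R -> R) (t l : R) :
  I t -> (forall s, I s -> f s = g s) ->
  is_derive_within I f t l -> is_derive_within I g t l.
Proof.
intros It E Hd; apply is_derive_within_eps; [exact It |]; intros eps.
generalize (proj1 (is_derive_within_eps I f t l It) Hd eps); unfold within.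
apply filter_imp; intros y Hy Iy; rewrite <- (E y Iy), <- (E t It); auto.
Qed.

Lemma is_derive_within_comp (I : R -> Prop) (f g : R -> R) (t l m : R) :
  I t -> is_derive_within I f t l -> is_derive g (f t) m ->
  is_derive_within I (fun s => g (f s)) t (l * m).
Proof.
intros It Hf Hg; pose proof (within_locally_proper I t It) as PF.
apply filterdiff_ext_lin with (fun y : R => scal (scal y l) m).
- apply (filterdiff_comp f g (fun y => scal y l) (fun y => scal y m)); [exact Hf |].
  apply (filterdiff_locally (F := filtermap f (within I (locally t))) g (f t));
    [| exact Hg].
  intros P HP; exact (is_derive_within_continuous I f t l It Hf P HP).
- intros y; unfold scal; simpl; unfold mult; simpl; ring.
Qed.

Lemma is_derive_within_plus (I : R -> Prop) (f g : R -> R) (t l m : R) :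
  I t -> is_derive_within I f t l -> is_derive_within I g t m ->
  is_derive_within I (fun s => f s + g s) t (l + m).
Proof.
intros It Hf Hg; pose proof (within_locally_proper I t It) as PF.
apply filterdiff_ext_lin with (fun y : R => plus (scal y l) (scal y m)).
- apply (filterdiff_plus_fct (F := within I (locally t)) f g); assumption.
- intros y; unfold plus, scal; simpl; unfold mult; simpl; ring.
Qed.

Lemma is_derive_within_mult (I : R -> Prop) (f g : R -> R) (t l m : R) :
  I t -> is_derive_within I f t l -> is_derive_within I g t m ->
  is_derive_within I (fun s => f s * g s) t (l * g t + f t * m).
Proof.
intros It Hf Hg; pose proof (within_locally_proper I t It) as PF.
eapply filterdiff_ext_lin.
- apply (filterdiff_comp_2 (F := within I (locally t)) f g
           (fun x y : R => mult x y) _ _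
           (fun x y : R => plus (mult x (g t)) (mult (f t) y)) Hf Hg).
  apply (filterdiff_mult (K := R_AbsRing)
           (F := filtermap (fun s => (f s, g s)) (within I (locally t))) (f t, g t)).
  + intros P [eps HP].
    pose proof (proj1 (filterlim_locally _ _)
                  (is_derive_within_continuous I f t l It Hf) eps) as H1.
    pose proof (proj1 (filterlim_locally _ _)
                  (is_derive_within_continuous I g t m It Hg) eps) as H2.
    unfold filtermap; generalize (filter_and _ _ H1 H2); apply filter_imp.
    intros s Hs; apply HP; exact Hs.
  + intros; apply Rmult_comm.
- intros y; unfold plus, scal; simpl; unfold mult; simpl; ring.
Qed.

Lemma is_derive_on_pair (I : R -> Prop) (f : R -> R * R) (t : R) (l : R * R) :
  I t ->
  (is_derive_on I f t l <->
   is_derive_within I (fun s => fst (f s)) t (fst l) /\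
   is_derive_within I (fun s => snd (f s)) t (snd l)).
Proof.
intros It; pose proof (within_locally_proper I t It) as PF.
split.
- intros H; split.
  + apply (filterdiff_comp (F := within I (locally t)) f (@fst R R) _ (@fst R R) H).
    apply filterdiff_linear; apply (@is_linear_fst R_AbsRing R_NormedModule R_NormedModule).
  + apply (filterdiff_comp (F := within I (locally t)) f (@snd R R) _ (@snd R R) H).
    apply filterdiff_linear; apply (@is_linear_snd R_AbsRing R_NormedModule R_NormedModule).
- intros [H1 H2].
  assert (H : filterdiff (fun s => (fst (f s), snd (f s))) (within I (locally t))
                (fun y : R => (scal y (fst l), scal y (snd l)))).
  { apply (filterdiff_comp_2 (F := within I (locally t)) (fun s => fst (f s))
             (fun s => snd (f s)) (fun x y : R => (x, y)) _ _
             (fun x y : R => (x, y)) H1 H2).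
    apply filterdiff_linear.
    apply (@is_linear_prod R_AbsRing _ R_NormedModule R_NormedModule);
      [apply (@is_linear_fst R_AbsRing R_NormedModule R_NormedModule)
      | apply (@is_linear_snd R_AbsRing R_NormedModule R_NormedModule)]. }
  split; [apply (@is_linear_scal_l R_AbsRing (prod_NormedModule _ R_NormedModule R_NormedModule) l) |].
  intros x Hx eps; generalize (proj2 H x Hx eps); apply filter_imp.
  intros y; simpl; rewrite <- !surjective_pairing.
  intros Hy; exact Hy.
Qed.

(* The mean value theorem and the integrability criterion of the library ask
   for two-sided continuity, also at an endpoint belonging to [I]. *)
Lemma clamp_continuous (I : R -> Prop) (f : R -> R) (p q : R) :
  order_convex I -> continuous_on I f -> I p -> I q -> p <= q ->
  forall s, continuous (fun s => f (Rmax p (Rmin s q))) s.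
Proof.
intros CI Cf Ip Iq pq s.
assert (Hc : forall s, p <= Rmax p (Rmin s q) <= q).
{ intros r; split; [apply Rmax_l | apply Rmax_lub; [exact pq | apply Rmin_r]]. }
apply (filterlim_comp _ _ _ (fun s => Rmax p (Rmin s q)) f _
         (within I (locally (Rmax p (Rmin s q))))).
- intros P [eps HP]; exists eps; intros r Hr; apply HP.
  + change (Rabs (Rmax p (Rmin r q) - Rmax p (Rmin s q)) < eps).
    change (Rabs (r - s) < eps) in Hr.
    eapply Rle_lt_trans; [| exact Hr].
    unfold Rmax, Rmin; repeat destruct Rle_dec; apply Rabs_le_between;
      unfold Rabs; destruct Rcase_abs; lra.
  + exact (CI p q _ Ip Iq (Hc r)).
- exact (Cf _ (CI p q _ Ip Iq (Hc s))).
Qed.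

Lemma clamp_id (p q s : R) : p <= s <= q -> Rmax p (Rmin s q) = s.
Proof. intros H; unfold Rmax, Rmin; repeat destruct Rle_dec; lra. Qed.

Lemma ex_RInt_within (I : R -> Prop) (f : R -> R) (p q : R) :
  order_convex I -> continuous_on I f -> I p -> I q -> ex_RInt f p q.
Proof.
intros CI Cf.
assert (Hle : forall x y, I x -> I y -> x <= y -> ex_RInt f x y).
{ intros x y Ix Iy xy.
  apply ex_RInt_ext with (fun s => f (Rmax x (Rmin s y))).
  - intros s; rewrite Rmin_left, Rmax_right by exact xy; intros Hs.
    rewrite clamp_id; [reflexivity | lra].
  - apply (ex_RInt_continuous (V := R_CompleteNormedModule)); intros z _.
    apply (clamp_continuous I); assumption. }
intros Ip Iq; destruct (Rle_dec p q) as [H | H]; [auto |].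
apply ex_RInt_swap; apply Hle; auto; lra.
Qed.

Lemma RInt_within_minus (I : R -> Prop) (f : R -> R) (r p q : R) :
  order_convex I -> continuous_on I f -> I r -> I p -> I q ->
  RInt f r q - RInt f r p = RInt f p q.
Proof.
intros CI Cf Ir Ip Iq.
rewrite <- (RInt_Chasles f r p q) by (eapply ex_RInt_within; eassumption).
unfold plus; simpl; ring.
Qed.

Lemma RInt_within_swap (I : R -> Prop) (f : R -> R) (p q : R) :
  order_convex I -> continuous_on I f -> I p -> I q ->
  RInt f q p = - RInt f p q.
Proof.
intros CI Cf Ip Iq; symmetry; apply (opp_RInt_swap f p q).
apply (ex_RInt_within I); assumption.
Qed.

Lemma MVT_within (I : R -> Prop) (f df : R -> R) (p q : R) :
  order_convex I -> (forall t, I t -> is_derive_within I f t (df t)) ->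
  I p -> I q -> p < q ->
  exists c, p <= c <= q /\ f q - f p = df c * (q - p).
Proof.
intros CI Hf Ip Iq pq.
assert (Cf : continuous_on I f).
{ intros t It; exact (is_derive_within_continuous I f t (df t) It (Hf t It)). }
destruct (MVT_gen (fun s => f (Rmax p (Rmin s q))) p q df) as [c [Hc E]].
- intros x; rewrite Rmin_left, Rmax_right by lra; intros Hx.
  assert (Hloc : locally x (fun y => p < y < q)).
  { apply (open_and _ _ (open_gt p) (open_lt q)); exact Hx. }
  apply is_derive_ext_loc with f.
  + generalize Hloc; apply filter_imp; intros y Hy; rewrite clamp_id; lra.
  + apply (is_derive_within_interior I).
    * generalize Hloc; apply filter_imp; intros y Hy; apply (CI p q); lra || assumption.
    * apply Hf; apply (CI p q); lra || assumption.
- intros x _; apply continuity_pt_filterlim.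
  apply (clamp_continuous I f p q); auto; lra.
- rewrite Rmin_left, Rmax_right in Hc by lra.
  rewrite (clamp_id p q q), (clamp_id p q p) in E by lra.
  exists c; split; assumption.
Qed.

Lemma is_derive_within_RInt (I : R -> Prop) (f : R -> R) (r t : R) :
  order_convex I -> continuous_on I f -> I r -> I t ->
  is_derive_within I (RInt f r) t (f t).
Proof.
intros CI Cf Ir It; apply is_derive_within_eps; [exact It |]; intros eps.
destruct (proj1 (filterlim_locally _ _) (Cf t It) eps) as [d Hd].
exists d; intros y Hy Iy; change (Rabs (y - t) < d) in Hy.
assert (Hle : forall p q, I p -> I q -> p <= q ->
  (forall s, p <= s <= q -> Rabs (s - t) < d) ->
  Rabs (RInt f p q - (q - p) * f t) <= eps * (q - p)).
{ intros p q Ip Iq pq Hs.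
  pose proof (ex_RInt_within I f p q CI Cf Ip Iq) as Ef.
  replace (RInt f p q - (q - p) * f t) with (RInt (fun s => minus (f s) (f t)) p q).
  - rewrite (Rmult_comm eps); apply abs_RInt_le_const; [exact pq | |].
    + apply (ex_RInt_minus (V := R_NormedModule)); [exact Ef | apply ex_RInt_const].
    + intros s Hpq; apply Rlt_le; apply Hd; [exact (Hs s Hpq) |].
      apply (CI p q); assumption.
  - rewrite (RInt_minus (V := R_CompleteNormedModule) f (fun _ => f t));
      [| exact Ef | apply ex_RInt_const].
    rewrite RInt_const; reflexivity. }
rewrite (RInt_within_minus I f r t y) by assumption.
destruct (Rle_dec t y) as [H | H].
- rewrite (Rabs_pos_eq (y - t)) in * by lra.
  apply Hle; auto; intros s Hs; rewrite Rabs_pos_eq; lra.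
- rewrite (Rabs_left1 (y - t)) in * by lra.
  rewrite (RInt_within_swap I f y t) by assumption.
  rewrite <- Rabs_Ropp.
  replace (- (- RInt f y t - (y - t) * f t)) with (RInt f y t - (t - y) * f t) by ring.
  replace (- (y - t)) with (t - y) by ring.
  apply Hle; auto; [lra |]; intros s Hs; rewrite Rabs_left1; lra.
Qed.

Lemma filterlim_plus_R {T} (F : (T -> Prop) -> Prop) {FF : Filter F}
  (f g : T -> R) (x y : R) :
  filterlim f F (locally x) -> filterlim g F (locally y) ->
  filterlim (fun t => f t + g t) F (locally (x + y)).
Proof.
intros Hf Hg; eapply filterlim_comp_2; [exact Hf | exact Hg |].
exact (filterlim_plus (K := R_AbsRing) (V := R_NormedModule) x y).
Qed.

Lemma filterlim_mult_R {T} (F : (T -> Prop) -> Prop) {FF : Filter F}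
  (f g : T -> R) (x y : R) :
  filterlim f F (locally x) -> filterlim g F (locally y) ->
  filterlim (fun t => f t * g t) F (locally (x * y)).
Proof.
intros Hf Hg; eapply filterlim_comp_2; [exact Hf | exact Hg |].
exact (filterlim_mult (K := R_AbsRing) x y).
Qed.

Lemma filterlim_affine_R {T} (F : (T -> Prop) -> Prop) {FF : Filter F}
  (f : T -> R) (c d x : R) :
  filterlim f F (locally x) ->
  filterlim (fun t => c * (f t - d)) F (locally (c * (x - d))).
Proof.
intros Hf; apply (filterlim_mult_R F (fun _ => c)); [apply filterlim_const |].
apply (filterlim_plus_R F f (fun _ => - d)); [exact Hf | apply filterlim_const].
Qed.

Lemma filterlim_pair_R {T} (F : (T -> Prop) -> Prop) {FF : Filter F}
  (f : T -> R * R) (v : R * R) :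
  filterlim (fun t => fst (f t)) F (locally (fst v)) ->
  filterlim (fun t => snd (f t)) F (locally (snd v)) ->
  filterlim f F (locally v).
Proof.
intros H1 H2; apply filterlim_locally; intros eps.
generalize (filter_and _ _ (proj1 (filterlim_locally _ _) H1 eps)
                           (proj1 (filterlim_locally _ _) H2 eps)).
apply filter_imp; intros t Ht; exact Ht.
Qed.

Lemma filterlim_of_increment_le {T} (F : (T -> Prop) -> Prop) {FF : ProperFilter F}
  (D : T -> Prop) (f g : T -> R) (c l : R) :
  F D -> 0 <= c -> (forall s t, D s -> D t -> Rabs (g t - g s) <= c * Rabs (f t - f s)) ->
  filterlim f F (locally l) -> exists m, filterlim g F (locally m).
Proof.
intros HD Hc Hinc Hf.
apply (proj1 (filterlim_locally_cauchy (U := R_CompleteSpace) g)); intros eps.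
assert (Hr : 0 < eps / (c + 1)) by (apply Rdiv_lt_0_compat; [apply cond_pos | lra]).
destruct (proj2 (filterlim_locally_cauchy (U := R_CompleteSpace) f)
            (ex_intro _ l Hf) (mkposreal _ Hr)) as [P [HP Hc']].
exists (fun t => P t /\ D t); split; [apply filter_and; assumption |].
intros s t [Ps Ds] [Pt Dt].
change (Rabs (g t - g s) < eps).
pose proof (Hc' s t Ps Pt) as Hb; change (Rabs (f t - f s) < eps / (c + 1)) in Hb.
apply Rle_lt_trans with ((c + 1) * Rabs (f t - f s)).
- eapply Rle_trans; [exact (Hinc s t Ds Dt) |].
  pose proof (Rabs_pos (f t - f s)); nra.
- apply Rmult_lt_compat_l with (r := c + 1) in Hb; [| lra].
  replace ((c + 1) * (eps / (c + 1))) with (pos eps) in Hb by (field; lra); exact Hb.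
Qed.

Lemma sup_on_le (I : R -> Prop) (f : R -> R) (r : R) :
  Rbar_le (sup_on I f) r <-> forall t, I t -> f t <= r.
Proof.
destruct (Lub_Rbar_correct (fun y => exists t, I t /\ y = f t)) as [Hub Hlub].
split.
- intros H t It.
  exact (Rbar_le_trans (f t) (sup_on I f) r (Hub _ (ex_intro _ t (conj It eq_refl))) H).
- intros H; apply Hlub; intros y [t [It ->]]; exact (H t It).
Qed.

Lemma le_real_sup_on (I : R -> Prop) (f : R -> R) (t : R) :
  Rbar_lt (sup_on I f) p_infty -> I t -> f t <= real (sup_on I f).
Proof.
intros Hlt It.
destruct (Lub_Rbar_correct (fun y => exists t, I t /\ y = f t)) as [Hub _].
pose proof (Hub _ (ex_intro _ t (conj It eq_refl))) as H.
unfold sup_on in *; destruct (Lub_Rbar _); simpl in *; tauto.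
Qed.

Lemma enorm_le_sqr (v : R * R) (r : R) :
  0 <= r -> (enorm v <= r <-> fst v * fst v + snd v * snd v <= r * r).
Proof.
intros Hr; unfold enorm.
rewrite !RPow_abs, !Rabs_pos_eq by apply pow2_ge_0.
assert (H0 : 0 <= fst v ^ 2 + snd v ^ 2) by nra.
split; intros H.
- pose proof (sqrt_sqrt _ H0) as E; pose proof (sqrt_pos (fst v ^ 2 + snd v ^ 2)); nra.
- apply Rsqr_incr_0_var; [| exact Hr].
  rewrite Rsqr_sqrt by exact H0; unfold Rsqr; lra.
Qed.

(* With [w] the total increment of [(z1, z2)], the scalar function
   [w1 z1 + w2 z2 - |w| c J] is nonincreasing by Cauchy-Schwarz. *)
Lemma plane_increment_le (I : R -> Prop) (z1 z2 d1 d2 J e : R -> R) (c : R) :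
  order_convex I -> 0 <= c -> (forall t, I t -> 0 <= e t) ->
  (forall t, I t -> is_derive_within I z1 t (d1 t)) ->
  (forall t, I t -> is_derive_within I z2 t (d2 t)) ->
  (forall t, I t -> is_derive_within I J t (e t)) ->
  (forall t, I t -> d1 t * d1 t + d2 t * d2 t <= c * e t * (c * e t)) ->
  forall t u, I t -> I u ->
  (z1 u - z1 t) * (z1 u - z1 t) + (z2 u - z2 t) * (z2 u - z2 t)
  <= c * (J u - J t) * (c * (J u - J t)).
Proof.
intros CI Hc He Hz1 Hz2 HJ Hd.
assert (Hlt : forall t u, I t -> I u -> t < u ->
  (z1 u - z1 t) * (z1 u - z1 t) + (z2 u - z2 t) * (z2 u - z2 t)
  <= c * (J u - J t) * (c * (J u - J t))).
{ intros t u It Iu tu.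
  set (w1 := z1 u - z1 t); set (w2 := z2 u - z2 t).
  assert (Hw : 0 <= w1 * w1 + w2 * w2) by nra.
  set (n := sqrt (w1 * w1 + w2 * w2)).
  assert (Hn : 0 <= n) by apply sqrt_pos.
  assert (Hnn : n * n = w1 * w1 + w2 * w2) by (apply sqrt_sqrt; exact Hw).
  destruct (MVT_within I (fun s => w1 * z1 s + w2 * z2 s + - (n * c) * J s)
              (fun s => w1 * d1 s + w2 * d2 s + - (n * c) * e s) t u)
    as [x [Hx E]]; auto.
  { intros s Is.
    assert (Hscal : forall k f l, is_derive_within I f s l ->
              is_derive_within I (fun r => k * f r) s (k * l)).
    { intros k f l Hf.
      apply is_derive_within_eq with (0 * f s + k * l); [| ring].
      apply (is_derive_within_mult I (fun _ => k) f); auto.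
      apply is_derive_within_of_is_derive; [exact Is | apply (is_derive_const k s)]. }
    repeat apply is_derive_within_plus; auto. }
  assert (Ix : I x) by (apply (CI t u); auto).
  assert (CS : w1 * d1 x + w2 * d2 x <= n * (c * e x)).
  { specialize (Hd x Ix); specialize (He x Ix).
    assert (0 <= n * (c * e x)) by (repeat apply Rmult_le_pos; auto).
    apply Rsqr_incr_0_var; [| assumption]; unfold Rsqr.
    replace (n * (c * e x) * (n * (c * e x))) with (n * n * (c * e x * (c * e x))) by ring.
    rewrite Hnn; apply Rle_trans with ((w1 * w1 + w2 * w2) * (d1 x * d1 x + d2 x * d2 x)).
    - pose proof (Rle_0_sqr (w1 * d2 x - w2 * d1 x)); unfold Rsqr in *; nra.
    - apply Rmult_le_compat_l; assumption. }
  assert (Hle : n * n <= n * (c * (J u - J t))).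
  { rewrite Hnn.
    assert ((w1 * d1 x + w2 * d2 x + - (n * c) * e x) * (u - t) <= 0) by nra.
    unfold w1, w2 in *; lra. }
  rewrite <- Hnn; destruct (Req_dec n 0) as [-> | Hn0].
  - rewrite Rmult_0_l; apply Rle_0_sqr.
  - assert (n <= c * (J u - J t)) by (apply Rmult_le_reg_l with n; lra).
    apply Rmult_le_compat; lra. }
intros t u It Iu; destruct (Rtotal_order t u) as [H | [-> | H]].
- auto.
- apply Req_le; ring.
- specialize (Hlt u t Iu It H); lra.
Qed.

Lemma mulmv_inv2_sysX (alpha beta : R -> R) (t0 t : R) (p : R * R) :
  mulmv (inv2 (sysX alpha beta t0 t)) p =
  (exp (- RInt alpha t0 t) * (cos (RInt beta t0 t) * fst p - sin (RInt beta t0 t) * snd p),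
   exp (- RInt alpha t0 t) * (sin (RInt beta t0 t) * fst p + cos (RInt beta t0 t) * snd p)).
Proof.
unfold mulmv, inv2; rewrite det2_sysX, exp_Ropp.
pose proof (exp_pos (RInt alpha t0 t)) as He.
unfold sysX, mat2, coeff_mat; simpl.
apply f_equal2; field; lra.
Qed.

Lemma mulmv_sysX (alpha beta : R -> R) (t0 t : R) (v : R * R) :
  mulmv (sysX alpha beta t0 t) v =
  (exp (RInt alpha t0 t) * (cos (RInt beta t0 t) * fst v + sin (RInt beta t0 t) * snd v),
   exp (RInt alpha t0 t) * (cos (RInt beta t0 t) * snd v - sin (RInt beta t0 t) * fst v)).
Proof. unfold mulmv, sysX, mat2, coeff_mat; simpl; apply f_equal2; ring. Qed.

Lemma mulmv_sysX_inv2 (alpha beta : R -> R) (t0 t : R) (p : R * R) :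
  mulmv (sysX alpha beta t0 t) (mulmv (inv2 (sysX alpha beta t0 t)) p) = p.
Proof.
rewrite mulmv_inv2_sysX, mulmv_sysX, exp_Ropp; simpl.
pose proof (exp_pos (RInt alpha t0 t)) as He.
pose proof (sin2_cos2 (RInt beta t0 t)) as H; unfold Rsqr in H.
set (C := cos _) in *; set (S := sin _) in *.
destruct p as [p1 p2]; simpl; apply f_equal2; field_simplify; try lra.
- transitivity ((S * S + C * C) * p1); [ring | rewrite H; ring].
- transitivity ((S * S + C * C) * p2); [ring | rewrite H; ring].
Qed.

Lemma sysX_isometry_exp (alpha beta : R -> R) (t0 t : R) (v w : R * R) :
  let d := minus (mulmv (sysX alpha beta t0 t) v) (mulmv (sysX alpha beta t0 t) w) in
  fst d * fst d + snd d * snd d =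
  exp (RInt alpha t0 t) * exp (RInt alpha t0 t) *
  ((fst v - fst w) * (fst v - fst w) + (snd v - snd w) * (snd v - snd w)).
Proof.
rewrite !mulmv_sysX; unfold minus, plus, opp; simpl; unfold plus, opp; simpl.
pose proof (sin2_cos2 (RInt beta t0 t)) as H; unfold Rsqr in H.
set (e := exp _); set (C := cos _) in *; set (S := sin _) in *.
transitivity (e * e * (S * S + C * C) *
  ((fst v - fst w) * (fst v - fst w) + (snd v - snd w) * (snd v - snd w)));
  [ring | rewrite H; ring].
Qed.

Lemma enorm_inv2_sysX_le (alpha beta : R -> R) (t0 t c : R) (p : R * R) :
  enorm p <= c ->
  let q := mulmv (inv2 (sysX alpha beta t0 t)) p in
  fst q * fst q + snd q * snd q
  <= c * exp (- RInt alpha t0 t) * (c * exp (- RInt alpha t0 t)).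
Proof.
intros Hp.
assert (Hc : 0 <= c) by (eapply Rle_trans; [apply sqrt_pos | exact Hp]).
apply enorm_le_sqr in Hp; [| exact Hc].
rewrite mulmv_inv2_sysX; simpl.
pose proof (sin2_cos2 (RInt beta t0 t)) as H; unfold Rsqr in H.
set (e := exp _); set (C := cos _) in *; set (S := sin _) in *.
replace (c * e * (c * e)) with (e * e * (c * c)) by ring.
apply Rle_trans with (e * e * ((S * S + C * C) * (fst p * fst p + snd p * snd p))).
- apply Req_le; ring.
- rewrite H, Rmult_1_l; apply Rmult_le_compat_l; [apply Rle_0_sqr | exact Hp].
Qed.

Lemma is_derive_within_exp_RInt (I : R -> Prop) (alpha : R -> R) (t0 t k : R) :
  order_convex I -> continuous_on I alpha -> I t0 -> I t ->
  is_derive_within I (fun s => exp (k * RInt alpha t0 s)) t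
    (k * alpha t * exp (k * RInt alpha t0 t)).
Proof.
intros CI Ca I0 It.
apply is_derive_within_eq with (alpha t * (k * exp (k * RInt alpha t0 t))); [| ring].
apply (is_derive_within_comp I (RInt alpha t0) (fun x => exp (k * x))); [exact It | |].
- apply is_derive_within_RInt; assumption.
- auto_derive; [exact Logic.I | ring].
Qed.

Lemma is_derive_within_cos_RInt (I : R -> Prop) (beta : R -> R) (t0 t : R) :
  order_convex I -> continuous_on I beta -> I t0 -> I t ->
  is_derive_within I (fun s => cos (RInt beta t0 s)) t (beta t * - sin (RInt beta t0 t)).
Proof.
intros CI Cb I0 It.
apply (is_derive_within_comp I (RInt beta t0) cos); [exact It | |].
- apply is_derive_within_RInt; assumption.
- auto_derive; [exact Logic.I | ring].
Qed.

Lemma is_derive_within_sin_RInt (I : R -> Prop) (beta : R -> R) (t0 t : R) :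
  order_convex I -> continuous_on I beta -> I t0 -> I t ->
  is_derive_within I (fun s => sin (RInt beta t0 s)) t (beta t * cos (RInt beta t0 t)).
Proof.
intros CI Cb I0 It.
apply (is_derive_within_comp I (RInt beta t0) sin); [exact It | |].
- apply is_derive_within_RInt; assumption.
- auto_derive; [exact Logic.I | ring].
Qed.

Lemma is_derive_within_exp_rotation (I : R -> Prop) (alpha beta f g : R -> R)
  (t0 t k s l m : R) :
  order_convex I -> continuous_on I alpha -> continuous_on I beta -> I t0 -> I t ->
  is_derive_within I f t l -> is_derive_within I g t m ->
  is_derive_within I
    (fun r => exp (k * RInt alpha t0 r) *
              (cos (RInt beta t0 r) * f r + s * (sin (RInt beta t0 r) * g r))) t
    (exp (k * RInt alpha t0 t) *
     (cos (RInt beta t0 t) * (l + k * alpha t * f t + s * beta t * g t) +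
      s * (sin (RInt beta t0 t) * (m + k * alpha t * g t)) -
      beta t * (sin (RInt beta t0 t) * f t))).
Proof.
intros CI Ca Cb I0 It Hf Hg.
eapply is_derive_within_eq.
- apply (is_derive_within_mult I (fun r => exp (k * RInt alpha t0 r))); [exact It | |].
  + apply is_derive_within_exp_RInt; assumption.
  + apply (is_derive_within_plus I (fun r => cos (RInt beta t0 r) * f r)); [exact It | |].
    * apply (is_derive_within_mult I (fun r => cos (RInt beta t0 r))); [exact It | | exact Hf].
      apply is_derive_within_cos_RInt; assumption.
    * apply (is_derive_within_mult I (fun _ => s)); [exact It | |].
      -- apply is_derive_within_of_is_derive; [exact It | apply (is_derive_const s t)].
      -- apply (is_derive_within_mult I (fun r => sin (RInt beta t0 r)));
           [exact It | | exact Hg].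
         apply is_derive_within_sin_RInt; assumption.
- unfold zero; simpl; ring.
Qed.

Lemma is_solution_sysX (I : R -> Prop) (alpha beta : R -> R) (t0 : R) (v : R * R) :
  order_convex I -> continuous_on I alpha -> continuous_on I beta -> I t0 ->
  is_solution I (sysA alpha beta) (fun t => mulmv (sysX alpha beta t0 t) v).
Proof.
intros CI Ca Cb I0 t It; apply is_derive_on_pair; [exact It |].
assert (Hc : forall c, is_derive_within I (fun _ => c) t 0).
{ intros c; apply is_derive_within_of_is_derive; [exact It | apply (is_derive_const c t)]. }
rewrite mulmv_sysX; split.
- eapply is_derive_within_ext; [exact It | |].
  2: eapply is_derive_within_eq;
     [apply (is_derive_within_exp_rotation I alpha beta (fun _ => fst v) (fun _ => snd v)
               t0 t 1 1 0 0); auto |].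
  + intros s _; rewrite mulmv_sysX; simpl; rewrite !Rmult_1_l; reflexivity.
  + unfold mulmv, sysA, mat2, coeff_mat; simpl; rewrite Rmult_1_l; ring.
- eapply is_derive_within_ext; [exact It | |].
  2: eapply is_derive_within_eq;
     [apply (is_derive_within_exp_rotation I alpha beta (fun _ => snd v) (fun _ => fst v)
               t0 t 1 (-1) 0 0); auto |].
  + intros s _; rewrite mulmv_sysX; simpl; rewrite !Rmult_1_l; ring.
  + unfold mulmv, sysA, mat2, coeff_mat; simpl; rewrite Rmult_1_l; ring.
Qed.

Lemma is_derive_on_inv2_sysX (I : R -> Prop) (alpha beta : R -> R) (t0 t : R)
  (phi : R -> R * R) (l : R * R) :
  order_convex I -> continuous_on I alpha -> continuous_on I beta -> I t0 -> I t ->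
  is_derive_on I phi t l ->
  is_derive_on I (fun s => mulmv (inv2 (sysX alpha beta t0 s)) (phi s)) t
    (mulmv (inv2 (sysX alpha beta t0 t)) (minus l (mulmv (sysA alpha beta t) (phi t)))).
Proof.
intros CI Ca Cb I0 It Hphi.
apply is_derive_on_pair in Hphi; [| exact It]; destruct Hphi as [H1 H2].
apply is_derive_on_pair; [exact It |]; rewrite mulmv_inv2_sysX; split.
- eapply is_derive_within_ext; [exact It | |].
  2: eapply is_derive_within_eq;
     [apply (is_derive_within_exp_rotation I alpha beta (fun s => fst (phi s))
               (fun s => snd (phi s)) t0 t (-1) (-1)); eauto |].
  + intros s _; rewrite mulmv_inv2_sysX; simpl.
    replace (-1 * RInt alpha t0 s) with (- RInt alpha t0 s) by ring; ring.
  + unfold mulmv, sysA, mat2, coeff_mat, minus, plus, opp; simpl; unfold plus, opp; simpl.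
    replace (-1 * RInt alpha t0 t) with (- RInt alpha t0 t) by ring; ring.
- eapply is_derive_within_ext; [exact It | |].
  2: eapply is_derive_within_eq;
     [apply (is_derive_within_exp_rotation I alpha beta (fun s => snd (phi s))
               (fun s => fst (phi s)) t0 t (-1) 1); eauto |].
  + intros s _; rewrite mulmv_inv2_sysX; simpl.
    replace (-1 * RInt alpha t0 s) with (- RInt alpha t0 s) by ring; ring.
  + unfold mulmv, sysA, mat2, coeff_mat, minus, plus, opp; simpl; unfold plus, opp; simpl.
    replace (-1 * RInt alpha t0 t) with (- RInt alpha t0 t) by ring; ring.
Qed.

(* The integrand is the operator norm of [X^{-1}]. *)
Definition decayJ (alpha : R -> R) (t0 : R) : R -> R :=
  RInt (fun s => exp (- RInt alpha t0 s)) t0.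

Lemma is_derive_within_decayJ (I : R -> Prop) (alpha : R -> R) (t0 t : R) :
  order_convex I -> continuous_on I alpha -> I t0 -> I t ->
  is_derive_within I (decayJ alpha t0) t (exp (- RInt alpha t0 t)) /\
  continuous_on I (fun s => exp (- RInt alpha t0 s)).
Proof.
intros CI Ca I0 It.
assert (Ce : continuous_on I (fun s => exp (- RInt alpha t0 s))).
{ intros s Is.
  apply (is_derive_within_continuous I (fun r => exp (- RInt alpha t0 r)) s
           (-1 * alpha s * exp (-1 * RInt alpha t0 s)) Is).
  eapply is_derive_within_ext;
    [exact Is | | apply is_derive_within_exp_RInt; eassumption].
  intros r _; simpl; f_equal; ring. }
split; [| exact Ce].
apply (is_derive_within_RInt I (fun s => exp (- RInt alpha t0 s))); assumption.
Qed.

Lemma RInt_exp_decayJ (I : R -> Prop) (alpha : R -> R) (t0 t u : R) :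
  order_convex I -> continuous_on I alpha -> I t0 -> I t -> I u ->
  RInt (fun s => exp (- RInt alpha t s)) t u =
  exp (RInt alpha t0 t) * (decayJ alpha t0 u - decayJ alpha t0 t).
Proof.
intros CI Ca I0 It Iu.
destruct (is_derive_within_decayJ I alpha t0 t CI Ca I0 It) as [_ Ce].
unfold decayJ; rewrite (RInt_within_minus I) by assumption.
rewrite <- (RInt_scal (V := R_CompleteNormedModule))
  by (apply (ex_RInt_within I); assumption).
apply (RInt_ext (V := R_CompleteNormedModule)); intros s Hs.
assert (Is : I s).
{ destruct (Rle_dec t u).
  - rewrite Rmin_left, Rmax_right in Hs by lra; apply (CI t u); lra || assumption.
  - rewrite Rmin_right, Rmax_left in Hs by lra; apply (CI u t); lra || assumption. }
unfold scal; simpl; unfold mult; simpl; rewrite <- exp_plus; f_equal.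
rewrite <- (RInt_within_minus I alpha t0 t s) by assumption; ring.
Qed.

Lemma decayJ_lt (I : R -> Prop) (alpha : R -> R) (t0 t u : R) :
  order_convex I -> continuous_on I alpha -> I t0 -> I t -> I u -> t < u ->
  decayJ alpha t0 t < decayJ alpha t0 u.
Proof.
intros CI Ca I0 It Iu tu.
destruct (MVT_within I (decayJ alpha t0) (fun s => exp (- RInt alpha t0 s)) t u)
  as [c [_ E]]; auto.
{ intros s Is; apply is_derive_within_decayJ; assumption. }
pose proof (exp_pos (- RInt alpha t0 c)); nra.
Qed.

Lemma inv2_sysX_increment_le (I : R -> Prop) (alpha beta : R -> R) (t0 c : R)
  (phi dphi : R -> R * R) :
  order_convex I -> continuous_on I alpha -> continuous_on I beta -> I t0 -> 0 <= c ->
  (forall t, I t -> is_derive_on I phi t (dphi t)) ->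
  (forall t, I t -> enorm (minus (dphi t) (mulmv (sysA alpha beta t) (phi t))) <= c) ->
  let Z := fun t => mulmv (inv2 (sysX alpha beta t0 t)) (phi t) in
  forall t u, I t -> I u ->
  (fst (Z u) - fst (Z t)) * (fst (Z u) - fst (Z t)) +
  (snd (Z u) - snd (Z t)) * (snd (Z u) - snd (Z t))
  <= c * (decayJ alpha t0 u - decayJ alpha t0 t) *
     (c * (decayJ alpha t0 u - decayJ alpha t0 t)).
Proof.
intros CI Ca Cb I0 Hc Hphi Hres Z.
set (g := fun t => mulmv (inv2 (sysX alpha beta t0 t))
                     (minus (dphi t) (mulmv (sysA alpha beta t) (phi t)))).
assert (HZ : forall t, I t -> is_derive_within I (fun s => fst (Z s)) t (fst (g t)) /\
                              is_derive_within I (fun s => snd (Z s)) t (snd (g t))).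
{ intros t It; apply is_derive_on_pair; [exact It |].
  exact (is_derive_on_inv2_sysX I alpha beta t0 t phi (dphi t) CI Ca Cb I0 It (Hphi t It)). }
apply (plane_increment_le I (fun s => fst (Z s)) (fun s => snd (Z s))
         (fun s => fst (g s)) (fun s => snd (g s)) (decayJ alpha t0)
         (fun s => exp (- RInt alpha t0 s))); auto.
- intros; apply Rlt_le, exp_pos.
- intros t It; exact (proj1 (HZ t It)).
- intros t It; exact (proj2 (HZ t It)).
- intros t It; apply is_derive_within_decayJ; assumption.
- intros t It; exact (enorm_inv2_sysX_le alpha beta t0 t c _ (Hres t It)).
Qed.

Lemma pair_eq_of_dist_le_0 (p q : R * R) :
  (fst p - fst q) * (fst p - fst q) + (snd p - snd q) * (snd p - snd q) <= 0 -> p = q.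
Proof.
destruct p as [p1 p2], q as [q1 q2]; simpl; intros H.
pose proof (Rle_0_sqr (p1 - q1)); pose proof (Rle_0_sqr (p2 - q2)).
apply f_equal2; apply Rminus_diag_uniq, Rsqr_0_uniq; unfold Rsqr in *; lra.
Qed.

Lemma is_solution_eq_sysX (I : R -> Prop) (alpha beta : R -> R) (t0 : R)
  (y : R -> R * R) :
  order_convex I -> continuous_on I alpha -> continuous_on I beta -> I t0 ->
  is_solution I (sysA alpha beta) y ->
  exists c, forall t, I t -> y t = mulmv (sysX alpha beta t0 t) c.
Proof.
intros CI Ca Cb I0 Hy.
exists (mulmv (inv2 (sysX alpha beta t0 t0)) (y t0)); intros t It.
rewrite <- (mulmv_sysX_inv2 alpha beta t0 t (y t)) at 1; f_equal.
pose proof (inv2_sysX_increment_le I alpha beta t0 0 y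
  (fun t => mulmv (sysA alpha beta t) (y t)) CI Ca Cb I0 (Rle_refl 0) Hy) as H.
assert (H0 : forall s, I s -> enorm (minus (mulmv (sysA alpha beta s) (y s))
                                      (mulmv (sysA alpha beta s) (y s))) <= 0).
{ intros s _; rewrite (minus_eq_zero (G := prod_AbelianGroup R_AbelianGroup R_AbelianGroup)).
  apply enorm_le_sqr; [apply Rle_refl |]; unfold zero; simpl; unfold zero; simpl; lra. }
specialize (H H0 t0 t I0 It); cbv beta zeta in H; rewrite !Rmult_0_l in H.
set (p := mulmv _ (y t)) in *; set (q := mulmv _ (y t0)) in *.
exact (pair_eq_of_dist_le_0 p q H).
Qed.

Lemma inv2_sysX_limit (I : R -> Prop) (F : (R -> Prop) -> Prop) {FF : ProperFilter F}
  (alpha beta : R -> R) (t0 L eps K : R) (phi dphi : R -> R * R) :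
  order_convex I -> continuous_on I alpha -> continuous_on I beta -> I t0 -> F I ->
  filterlim (decayJ alpha t0) F (locally L) ->
  (forall t, I t -> exp (RInt alpha t0 t) * Rabs (L - decayJ alpha t0 t) <= K) ->
  0 < eps -> is_C1_on I phi dphi -> residual_le I (sysA alpha beta) phi dphi eps ->
  exists v,
    filterlim (fun t => mulmv (inv2 (sysX alpha beta t0 t)) (phi t)) F (locally v) /\
    dist_le I phi (fun t => mulmv (sysX alpha beta t0 t) v) (K * eps).
Proof.
intros CI Ca Cb I0 FI HL HK Heps [Hphi _] Hres.
assert (HK0 : 0 <= K).
{ eapply Rle_trans; [| exact (HK t0 I0)].
  apply Rmult_le_pos; [apply Rlt_le, exp_pos | apply Rabs_pos]. }
pose proof (inv2_sysX_increment_le I alpha beta t0 eps phi dphi CI Ca Cb I0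
  (Rlt_le _ _ Heps) Hphi (proj1 (sup_on_le _ _ _) Hres)) as Hinc.
set (Z := fun t => mulmv (inv2 (sysX alpha beta t0 t)) (phi t)) in *; simpl in Hinc.
set (J := decayJ alpha t0) in *.
assert (Habs : forall a b m, a * a + b * b <= eps * m * (eps * m) ->
          Rabs a <= eps * Rabs m).
{ intros a b m H; rewrite <- (Rabs_pos_eq eps) by lra; rewrite <- Rabs_mult.
  apply Rsqr_le_abs_0; unfold Rsqr; nra. }
destruct (filterlim_of_increment_le F I J (fun t => fst (Z t)) eps L) as [v1 Hv1]; auto.
{ lra. }
{ intros s t Is It; exact (Habs _ _ _ (Hinc s t Is It)). }
destruct (filterlim_of_increment_le F I J (fun t => snd (Z t)) eps L) as [v2 Hv2]; auto.
{ lra. }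
{ intros s t Is It; apply (Habs _ (fst (Z t) - fst (Z s))).
  rewrite Rplus_comm; exact (Hinc s t Is It). }
exists (v1, v2); split.
{ exact (filterlim_pair_R F Z (v1, v2) Hv1 Hv2). }
apply sup_on_le; intros t It.
apply enorm_le_sqr; [apply Rmult_le_pos; lra |].
rewrite <- (mulmv_sysX_inv2 alpha beta t0 t (phi t)).
change (mulmv (inv2 (sysX alpha beta t0 t)) (phi t)) with (Z t).
pose proof (sysX_isometry_exp alpha beta t0 t (Z t) (v1, v2)) as E; cbv zeta in E.
eapply Rle_trans; [apply Req_le; exact E | clear E].
change (fst (v1, v2)) with v1; change (snd (v1, v2)) with v2.
set (e := exp (RInt alpha t0 t)) in *.
assert (Hlim : (v1 - fst (Z t)) * (v1 - fst (Z t)) + (v2 - snd (Z t)) * (v2 - snd (Z t))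
               <= eps * (L - J t) * (eps * (L - J t))).
{ apply (filterlim_le (F := F)
    (fun u => (fst (Z u) - fst (Z t)) * (fst (Z u) - fst (Z t)) +
              (snd (Z u) - snd (Z t)) * (snd (Z u) - snd (Z t)))
    (fun u => eps * (J u - J t) * (eps * (J u - J t)))
    (Finite ((v1 - fst (Z t)) * (v1 - fst (Z t)) + (v2 - snd (Z t)) * (v2 - snd (Z t))))
    (Finite (eps * (L - J t) * (eps * (L - J t))))).
  - generalize FI; apply filter_imp; intros u Iu; exact (Hinc t u It Iu).
  - assert (Hm : forall (f : R -> R) x d, filterlim f F (locally x) ->
              filterlim (fun u => (f u - d) * (f u - d)) F (locally ((x - d) * (x - d)))).
    { intros f x d Hf.
      assert (Hd : filterlim (fun u => f u - d) F (locally (x - d))).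
      { apply (filterlim_plus_R F f (fun _ => - d)); [exact Hf | apply filterlim_const]. }
      apply filterlim_mult_R; [apply FF | exact Hd | exact Hd]. }
    apply filterlim_plus_R; [apply FF | |]; apply Hm; [exact Hv1 | exact Hv2].
  - apply filterlim_mult_R; [apply FF | |]; apply filterlim_affine_R; assumption || apply FF. }
specialize (HK t It); fold e J in HK.
assert (He : 0 < e) by apply exp_pos.
apply Rle_trans with (e * Rabs (L - J t) * eps * (e * Rabs (L - J t) * eps)).
- apply Rle_trans with (e * e * (eps * (L - J t) * (eps * (L - J t)))).
  + apply Rmult_le_compat_l; [nra |].
    replace ((fst (Z t) - v1) * (fst (Z t) - v1) + (snd (Z t) - v2) * (snd (Z t) - v2))
      with ((v1 - fst (Z t)) * (v1 - fst (Z t)) + (v2 - snd (Z t)) * (v2 - snd (Z t)))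
      by ring.
    exact Hlim.
  + apply Req_le.
    transitivity (e * e * eps * eps * (Rabs (L - J t) * Rabs (L - J t))); [| ring].
    rewrite <- Rabs_mult, (Rabs_pos_eq ((L - J t) * (L - J t)))
      by apply Rle_0_sqr; ring.
- pose proof (Rabs_pos (L - J t)).
  assert (0 <= e * Rabs (L - J t) * eps) by (repeat apply Rmult_le_pos; lra).
  apply Rmult_le_compat; try assumption; apply Rmult_le_compat_r; lra.
Qed.

(* Two solutions within [r] of [phi] differ by [X c] with
   [exp (int alpha) |c| <= 2 r], and the exponential is unbounded. *)
Lemma is_unique_solution_within_sysX (I : R -> Prop) (F : (R -> Prop) -> Prop)
  {FF : ProperFilter F} (alpha beta : R -> R) (t0 r : R) (phi : R -> R * R) (v : R * R) :
  order_convex I -> continuous_on I alpha -> continuous_on I beta -> I t0 -> F I ->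
  filterlim (RInt alpha t0) F (Rbar_locally p_infty) -> 0 <= r ->
  dist_le I phi (fun t => mulmv (sysX alpha beta t0 t) v) r ->
  is_unique_solution_within I (sysA alpha beta) phi r
    (fun t => mulmv (sysX alpha beta t0 t) v).
Proof.
intros CI Ca Cb I0 FI Hinf Hr Hv.
split; [apply is_solution_sysX; assumption |]; split; [exact Hv |].
intros y Hy Hyr.
destruct (is_solution_eq_sysX I alpha beta t0 y CI Ca Cb I0 Hy) as [c Hc].
enough (c = v) as -> by exact Hc.
set (D := (fst c - fst v) * (fst c - fst v) + (snd c - snd v) * (snd c - snd v)).
assert (HD : D <= 0).
{ apply Rnot_lt_le; intros HD.
  set (M := 4 * (r * r) / D).
  assert (HM : 0 <= M) by (apply Rdiv_le_0_compat; nra).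
  assert (HF : F (fun t => I t /\ M < RInt alpha t0 t)).
  { apply filter_and; [exact FI |].
    apply (Hinf (fun x => M < x)); exists M; auto. }
  destruct (filter_ex _ HF) as [t [It Ht]].
  pose proof (proj1 (sup_on_le _ _ _) Hv t It) as H1.
  pose proof (proj1 (sup_on_le _ _ _) Hyr t It) as H2; cbv beta in H1, H2.
  rewrite (Hc t It) in H2.
  apply enorm_le_sqr in H1; [| exact Hr]; apply enorm_le_sqr in H2; [| exact Hr].
  pose proof (sysX_isometry_exp alpha beta t0 t c v) as E; cbv zeta in E.
  fold D in E; set (e := exp _) in E.
  assert (He : M < e) by (pose proof (exp_ineq1_le (RInt alpha t0 t)); unfold e; lra).
  assert (He1 : 1 <= e) by (pose proof (exp_ineq1_le (RInt alpha t0 t)); unfold e; lra).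
  assert (Hlt : 4 * (r * r) < e * e * D).
  { replace (4 * (r * r)) with (M * D) by (unfold M; field; lra).
    apply Rmult_lt_compat_r; [exact HD | nra]. }
  set (x := mulmv (sysX alpha beta t0 t) c) in *.
  set (z := mulmv (sysX alpha beta t0 t) v) in *.
  clearbody x z; rewrite <- E in Hlt; revert Hlt H1 H2.
  unfold minus, plus, opp; simpl; unfold plus, opp; simpl.
  generalize (fst (phi t)) (snd (phi t)) (fst x) (snd x) (fst z) (snd z).
  intros p1 p2 x1 x2 z1 z2 Hlt H1 H2.
  pose proof (Rle_0_sqr (2 * p1 - x1 - z1)); pose proof (Rle_0_sqr (2 * p2 - x2 - z2)).
  unfold Rsqr in *; nra. }
exact (pair_eq_of_dist_le_0 c v HD).
Qed.

(* [kap] stands for [kappa31] ([sg = 1], [F = left_of b]) or [kappa32]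
   ([sg = -1], [F = right_of a]). *)
Lemma Ulam_stability_from_end (I : R -> Prop) (F : (R -> Prop) -> Prop)
  {FF : ProperFilter F} (alpha beta : R -> R) (t0 t1 sg : R) (kap : R -> R) :
  order_convex I -> continuous_on I alpha -> continuous_on I beta ->
  I t0 -> I t1 -> t0 <> t1 -> F I -> Rabs sg = 1 ->
  (forall t, I t -> F (fun u => 0 <= sg * (u - t)) \/ is_filter_lim F t) ->
  (forall t, I t ->
     filterlim (fun u => sg * RInt (fun s => exp (- RInt alpha t s)) t u) F
       (locally (kap t))) ->
  Rbar_lt (sup_on I kap) p_infty ->
  let A := sysA alpha beta in
  let X := sysX alpha beta t0 in
  let K := real (sup_on I kap) in
  Ulam_stable I A /\ is_Ulam_constant I A K /\
  (filterlim (RInt alpha t0) F (Rbar_locally p_infty) ->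
   forall (eps : R) (phi dphi : R -> R * R),
   0 < eps -> is_C1_on I phi dphi -> residual_le I A phi dphi eps ->
   exists v : R * R,
     filterlim (fun t => mulmv (inv2 (X t)) (phi t)) F (locally v) /\
     is_unique_solution_within I A phi (K * eps) (fun t => mulmv (X t) v)).
Proof.
intros CI Ca Cb I0 I1 H01 FI Hsg Hside Hkap Hsup A X K.
assert (Hsg2 : sg * sg = 1).
{ rewrite <- (Rabs_pos_eq (sg * sg)) by apply Rle_0_sqr; rewrite Rabs_mult, Hsg; ring. }
set (J := decayJ alpha t0).
assert (HJlt : forall t u, I t -> I u -> t < u -> J t < J u).
{ intros t u It Iu; exact (decayJ_lt I alpha t0 t u CI Ca I0 It Iu). }
assert (HJ0 : J t0 = 0) by (exact (RInt_point t0 (fun s => exp (- RInt alpha t0 s)))).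
assert (Ha0 : exp (RInt alpha t0 t0) = 1) by (rewrite RInt_point; apply exp_0).
set (L := sg * kap t0).
assert (Hk : forall t, I t ->
  filterlim (fun u => sg * exp (RInt alpha t0 t) * (J u - J t)) F (locally (kap t))).
{ intros t It; apply filterlim_ext_loc with (2 := Hkap t It).
  generalize FI; apply filter_imp; intros u Iu.
  rewrite (RInt_exp_decayJ I alpha t0 t u) by assumption; unfold J; ring. }
assert (HL : filterlim J F (locally L)).
{ apply filterlim_ext with
    (fun u => sg * (sg * exp (RInt alpha t0 t0) * (J u - J t0) - 0)).
  - intros u; rewrite Ha0, HJ0; transitivity (sg * sg * J u); [ring |].
    rewrite Hsg2; ring.
  - replace L with (sg * (kap t0 - 0)) by (unfold L; ring).
    apply filterlim_affine_R; [apply FF | exact (Hk t0 I0)]. }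
assert (Hkeq : forall t, I t -> kap t = sg * exp (RInt alpha t0 t) * (L - J t)).
{ intros t It.
  apply (filterlim_locally_unique (K := R_AbsRing) (V := R_NormedModule) (F := F)
           (fun u => sg * exp (RInt alpha t0 t) * (J u - J t))); [exact (Hk t It) |].
  apply filterlim_affine_R; [apply FF | exact HL]. }
assert (Hsign : forall t, I t -> 0 <= sg * (L - J t)).
{ intros t It; destruct (Hside t It) as [Hs | Hs].
  - apply (filterlim_le (F := F) (fun _ => 0) (fun u => sg * (J u - J t))
             (Finite 0) (Finite (sg * (L - J t)))).
    + generalize (filter_and _ _ FI Hs); apply filter_imp; intros u [Iu Hu].
      destruct (Rtotal_order t u) as [H | [<- | H]].
      * pose proof (HJlt t u It Iu H).
        assert (0 <= sg) by nra; nra.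
      * rewrite Rminus_diag, Rmult_0_r; apply Rle_refl.
      * pose proof (HJlt u t Iu It H).
        assert (sg <= 0) by nra; nra.
    + apply filterlim_const.
    + apply filterlim_affine_R; [apply FF | exact HL].
  - enough (L = J t) as -> by (rewrite Rminus_diag, Rmult_0_r; apply Rle_refl).
    apply (filterlim_locally_unique (K := R_AbsRing) (V := R_NormedModule) (F := F) J);
      [exact HL |].
    destruct (is_derive_within_decayJ I alpha t0 t CI Ca I0 It) as [HdJ _].
    intros P HP; unfold filtermap.
    pose proof (Hs _ (is_derive_within_continuous I (decayJ alpha t0) t _ It HdJ P HP)) as HF.
    generalize (filter_and _ _ FI HF); apply filter_imp; tauto. }
assert (HK : forall t, I t -> exp (RInt alpha t0 t) * Rabs (L - J t) <= K).
{ intros t It; eapply Rle_trans; [| exact (le_real_sup_on I kap t Hsup It)].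
  rewrite (Hkeq t It); apply Req_le.
  replace (Rabs (L - J t)) with (Rabs sg * Rabs (L - J t)) by (rewrite Hsg; ring).
  rewrite <- Rabs_mult, Rabs_pos_eq by exact (Hsign t It); ring. }
assert (HK0 : 0 <= K).
{ eapply Rle_trans; [| exact (HK t0 I0)].
  apply Rmult_le_pos; [apply Rlt_le, exp_pos | apply Rabs_pos]. }
assert (HKpos : 0 < K).
{ destruct HK0 as [H | H]; [exact H | exfalso].
  assert (HJ : forall t, I t -> L = J t).
  { intros t It; specialize (HK t It); rewrite <- H in HK.
    pose proof (exp_pos (RInt alpha t0 t)); pose proof (Rabs_pos (L - J t)).
    apply Rminus_diag_uniq.
    destruct (Req_dec (L - J t) 0) as [E | E]; [exact E |].
    apply Rabs_pos_lt in E; nra. }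
  pose proof (HJ t0 I0); pose proof (HJ t1 I1).
  destruct (Rtotal_order t0 t1) as [Hlt | [E | Hlt]]; [| contradiction |].
  - pose proof (HJlt t0 t1 I0 I1 Hlt); lra.
  - pose proof (HJlt t1 t0 I1 I0 Hlt); lra. }
assert (HU : is_Ulam_constant I A K).
{ split; [exact HKpos |]; intros eps phi dphi Heps HC1 Hres.
  destruct (inv2_sysX_limit I F alpha beta t0 L eps K phi dphi) as [v [_ Hv]]; auto.
  exists (fun t => mulmv (X t) v); split; [| exact Hv].
  apply is_solution_sysX; assumption. }
split; [exists K; exact HU |]; split; [exact HU |].
intros Hinf eps phi dphi Heps HC1 Hres.
destruct (inv2_sysX_limit I F alpha beta t0 L eps K phi dphi) as [v [Hlim Hv]]; auto.
exists v; split; [exact Hlim |].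
apply (is_unique_solution_within_sysX I F); auto.
apply Rmult_le_pos; lra.
Qed.

Lemma interval_order_convex (a b : Rbar) (ca cb : bool) :
  order_convex (interval a b ca cb).
Proof.
intros x y z [Hx _] [_ Hy] [Hxz Hzy]; split.
- destruct ca, a; simpl in *; auto; lra.
- destruct cb, b; simpl in *; auto; lra.
Qed.

Lemma left_of_gt (b : Rbar) (t : R) : Rbar_lt t b -> left_of b (fun u => t < u).
Proof.
unfold left_of, within; destruct b as [b | |]; simpl; intros H.
- generalize (open_gt t b H); apply filter_imp; auto.
- exists t; auto.
- contradiction.
Qed.

Lemma right_of_lt (a : Rbar) (t : R) : Rbar_lt a t -> right_of a (fun u => u < t).
Proof.
unfold right_of, within; destruct a as [a | |]; simpl; intros H.
- generalize (open_lt t a H); apply filter_imp; auto.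
- contradiction.
- exists t; auto.
Qed.

Lemma left_of_proper (b : Rbar) : b <> m_infty -> ProperFilter (left_of b).
Proof.
intros Hb; destruct b as [b | |]; [exact (at_left_proper_filter b) | | tauto].
constructor; [| apply within_filter, Rbar_locally_filter].
intros P [M HM]; exists (M + 1); apply HM; simpl; auto; lra.
Qed.

Lemma right_of_proper (a : Rbar) : a <> p_infty -> ProperFilter (right_of a).
Proof.
intros Ha; destruct a as [a | |]; [exact (at_right_proper_filter a) | tauto |].
constructor; [| apply within_filter, Rbar_locally_filter].
intros P [M HM]; exists (M - 1); apply HM; simpl; auto; lra.
Qed.

Lemma left_of_interval (a b : Rbar) (ca cb : bool) :
  Rbar_lt a b -> left_of b (interval a b ca cb).
Proof.
unfold left_of, within, interval; intros H.
destruct a as [a | |], b as [b | |]; simpl in *; try contradiction.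
- generalize (open_gt a b H); apply filter_imp; intros u Hu Hub.
  split; [destruct ca | destruct cb]; simpl; lra.
- exists a; intros u Hu _; split; [destruct ca | destruct cb]; simpl; auto; lra.
- apply filter_forall; intros u Hub; split; [destruct ca | destruct cb]; simpl; auto; lra.
- exists 0; intros u _ _; split; [destruct ca | destruct cb]; simpl; auto.
Qed.

Lemma right_of_interval (a b : Rbar) (ca cb : bool) :
  Rbar_lt a b -> right_of a (interval a b ca cb).
Proof.
unfold right_of, within, interval; intros H.
destruct a as [a | |], b as [b | |]; simpl in *; try contradiction.
- generalize (open_lt b a H); apply filter_imp; intros u Hu Hua.
  split; [destruct ca | destruct cb]; simpl; lra.
- apply filter_forall; intros u Hua; split; [destruct ca | destruct cb]; simpl; auto; lra.
- exists b; intros u Hu _; split; [destruct ca | destruct cb]; simpl; auto; lra.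
- exists 0; intros u _ _; split; [destruct ca | destruct cb]; simpl; auto.
Qed.

Lemma interval_left_of (a b : Rbar) (ca cb : bool) (t : R) :
  interval a b ca cb t ->
  left_of b (fun u => 0 <= 1 * (u - t)) \/ is_filter_lim (left_of b) t.
Proof.
intros [_ Ht].
assert (Hle : Rbar_le t b) by (destruct cb; [exact Ht | apply Rbar_lt_le; exact Ht]).
destruct (Rbar_le_lt_or_eq_dec _ _ Hle) as [H | <-].
- left; assert (FL : Filter (left_of b)) by (apply within_filter, Rbar_locally_filter).
  generalize (left_of_gt b t H); apply filter_imp; intros; lra.
- right; intros P HP; exact (filter_le_within _ P HP).
Qed.

Lemma interval_right_of (a b : Rbar) (ca cb : bool) (t : R) :
  interval a b ca cb t ->
  right_of a (fun u => 0 <= -1 * (u - t)) \/ is_filter_lim (right_of a) t.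
Proof.
intros [Ht _].
assert (Hle : Rbar_le a t) by (destruct ca; [exact Ht | apply Rbar_lt_le; exact Ht]).
destruct (Rbar_le_lt_or_eq_dec _ _ Hle) as [H | ->].
- left; assert (FR : Filter (right_of a)) by (apply within_filter, Rbar_locally_filter).
  generalize (right_of_lt a t H); apply filter_imp; intros; lra.
- right; intros P HP; exact (filter_le_within _ P HP).
Qed.

Lemma is_RInt_gen_at_point_l (F : (R -> Prop) -> Prop) {FF : Filter F}
  (f : R -> R) (t l : R) :
  is_RInt_gen f (at_point t) F l -> filterlim (fun u => RInt f t u) F (locally l).
Proof.
intros H P HP; destruct (H P HP) as [Q S HQ HS HQS].
unfold filtermap; generalize HS; apply filter_imp; intros u Su.
destruct (HQS t u HQ Su) as [y [Hy Py]].
rewrite (is_RInt_unique (V := R_CompleteNormedModule) f t u y Hy); exact Py.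
Qed.

Lemma is_RInt_gen_at_point_r (F : (R -> Prop) -> Prop) {FF : Filter F}
  (f : R -> R) (t l : R) :
  is_RInt_gen f F (at_point t) l -> filterlim (fun u => RInt f u t) F (locally l).
Proof.
intros H P HP; destruct (H P HP) as [Q S HQ HS HQS].
unfold filtermap; generalize HQ; apply filter_imp; intros u Qu.
destruct (HQS u t Qu HS) as [y [Hy Py]].
rewrite (is_RInt_unique (V := R_CompleteNormedModule) f u t y Hy); exact Py.
Qed.

Lemma RInt_exp_swap (I : R -> Prop) (alpha : R -> R) (t u : R) :
  order_convex I -> continuous_on I alpha -> I t -> I u ->
  RInt (fun s => exp (RInt alpha s t)) u t =
  -1 * RInt (fun s => exp (- RInt alpha t s)) t u.
Proof.
intros CI Ca It Iu.
transitivity (RInt (fun s => exp (- RInt alpha t s)) u t).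
- apply (RInt_ext (V := R_CompleteNormedModule)); intros s Hs.
  rewrite (RInt_within_swap I alpha t s); try assumption; [reflexivity |].
  destruct (Rle_dec u t).
  + rewrite Rmin_left, Rmax_right in Hs by lra; apply (CI u t); lra || assumption.
  + rewrite Rmin_right, Rmax_left in Hs by lra; apply (CI t u); lra || assumption.
- rewrite (RInt_within_swap I (fun s => exp (- RInt alpha t s)) t u); try assumption.
  + match goal with |- ?x = ?y => change (@eq R x y) end; ring.
  + exact (proj2 (is_derive_within_decayJ I alpha t t CI Ca It It)).
Qed.

Theorem theorem5p1 :
  forall (a b : Rbar) (ca cb : bool) (alpha beta : R -> R) (t0 : R),
  Rbar_lt a b ->
  let I := interval a b ca cb in
  continuous_on I alpha -> continuous_on I beta ->
  Rbar_lt a t0 -> Rbar_lt t0 b ->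
  let A := sysA alpha beta in
  let X := sysX alpha beta t0 in
  ((forall t, I t -> ex_kappa31 alpha b t) ->
   Rbar_lt (sup_on I (kappa31 alpha b)) p_infty ->
   let K31 := real (sup_on I (kappa31 alpha b)) in
   Ulam_stable I A /\ is_Ulam_constant I A K31 /\
   (filterlim (fun t => RInt alpha t0 t) (left_of b) (Rbar_locally p_infty) ->
    forall (eps : R) (phi dphi : R -> R * R),
    0 < eps -> is_C1_on I phi dphi -> residual_le I A phi dphi eps ->
    exists v : R * R,
      filterlim (fun t => mulmv (inv2 (X t)) (phi t)) (left_of b) (locally v) /\
      is_unique_solution_within I A phi (K31 * eps) (fun t => mulmv (X t) v)))
  /\
  ((forall t, I t -> ex_kappa32 alpha a t) ->
   Rbar_lt (sup_on I (kappa32 alpha a)) p_infty ->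
   let K32 := real (sup_on I (kappa32 alpha a)) in
   Ulam_stable I A /\ is_Ulam_constant I A K32 /\
   (filterlim (fun t => RInt alpha t t0) (right_of a) (Rbar_locally m_infty) ->
    forall (eps : R) (phi dphi : R -> R * R),
    0 < eps -> is_C1_on I phi dphi -> residual_le I A phi dphi eps ->
    exists v : R * R,
      filterlim (fun t => mulmv (inv2 (X t)) (phi t)) (right_of a) (locally v) /\
      is_unique_solution_within I A phi (K32 * eps) (fun t => mulmv (X t) v))).
Proof.
intros a b ca cb alpha beta t0 Hab I Ca Cb Ha Hb A X.
assert (CI : order_convex I) by apply interval_order_convex.
assert (I0 : I t0).
{ split; [destruct ca | destruct cb]; auto using Rbar_lt_le. }
split; intros Hex Hsup K.
- assert (FF : ProperFilter (left_of b)) by (apply left_of_proper; intros ->; exact Hb).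
  assert (FI : left_of b I) by (apply left_of_interval; exact Hab).
  destruct (filter_ex _ (filter_and _ _ FI (left_of_gt b t0 Hb))) as [t1 [I1 H1]].
  apply (Ulam_stability_from_end I (left_of b) alpha beta t0 t1 1 (kappa31 alpha b)); auto.
  + lra.
  + apply Rabs_R1.
  + intros t It; exact (interval_left_of a b ca cb t It).
  + intros t It; apply filterlim_ext with (fun u => RInt (fun s => exp (- RInt alpha t s)) t u).
    * intros u; symmetry; apply Rmult_1_l.
    * apply is_RInt_gen_at_point_l; [apply FF |].
      apply (RInt_gen_correct (V := R_CompleteNormedModule)); exact (Hex t It).
- assert (FF : ProperFilter (right_of a)).
  { apply right_of_proper; intros ->; exact Ha. }
  assert (FI : right_of a I) by (apply right_of_interval; exact Hab).
  destruct (filter_ex _ (filter_and _ _ FI (right_of_lt a t0 Ha))) as [t1 [I1 H1]].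
  destruct (Ulam_stability_from_end I (right_of a) alpha beta t0 t1 (-1) (kappa32 alpha a))
    as [HS [HU Hlim]]; auto.
  + lra.
  + rewrite Rabs_left; lra.
  + intros t It; exact (interval_right_of a b ca cb t It).
  + intros t It.
    apply filterlim_ext_loc with (fun u => RInt (fun s => exp (RInt alpha s t)) u t).
    * generalize FI; apply filter_imp; intros u Iu; apply (RInt_exp_swap I); assumption.
    * apply is_RInt_gen_at_point_r; [apply FF |].
      apply (RInt_gen_correct (V := R_CompleteNormedModule)); exact (Hex t It).
  + split; [exact HS |]; split; [exact HU |]; intros Hinf; apply Hlim.
    apply filterlim_ext_loc with (fun t => - RInt alpha t t0).
    * generalize FI; apply filter_imp; intros t It.
      rewrite (RInt_within_swap I alpha t0 t) by assumption; apply Ropp_involutive.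
    * exact (filterlim_comp _ _ _ _ _ _ _ _ Hinf (filterlim_Rbar_opp m_infty)).
Qed.
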